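(* Let $f_h$ and $f_\ell$ be probability densities with likelihood ratio $L=f_h/f_\ell$, let $Z$ be drawn from $f_h$ and $\xi=\ln L(Z)$, let $\rho\in(0,1)$, and let $Q$ be an increasing stochastic kernel on $\mathbb R$. Suppose that: (A1) $\mathrm{Var}(\ln L(Z))<\infty$; (A2) for all $\varepsilon>0$ there exists a compact $K\subset\mathbb R$ such that $\inf_{x\in\mathbb R}Q(x,K)\ge1-\varepsilon$; (A3) for every $M>0$, $\mathbb P\{L(Z)>M\}>0$ when $Z\sim f_h$. Then the belief shock kernel $P$, i.e. the stochastic kernel on $\mathbb R$ of $$\eta_{t+1}=I_{t+1}R_{t+1}+(1-I_{t+1})(\eta_t+\xi_{t+1}),\qquad R_{t+1}\sim Q(\eta_t,\cdot),$$ is globally stable on $(\mathcal P(\mathbb R),\beta)$.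
   Context: Here $f_h,f_\ell$ are densities of signals with respect to a common reference measure, $(Z_t)_{t\ge1}$ is iid with density $f_h$, $\xi_t=\ln L(Z_t)$, and $(I_t)_{t\ge1}$ is iid $\mathrm{Bernoulli}(\rho)$; given $\eta_t$, the shocks $I_{t+1}$, $R_{t+1}\sim Q(\eta_t,\cdot)$ and $\xi_{t+1}$ are independent. Thus $P(x,B)=\rho\,Q(x,B)+(1-\rho)\,\mathbb P\{x+\xi\in B\}$ for $x\in\mathbb R$ and Borel $B\subset\mathbb R$. $\mathcal P(\mathbb R)$ is the set of Borel probability measures on $\mathbb R$; $ib\mathbb R$ is the set of bounded increasing (Borel) functions on $\mathbb R$; $\phi(h)=\int h\,d\phi$; $\beta(\phi,\psi)=\sup\{|\phi(h)-\psi(h)|:h\in ib\mathbb R,\ |h|\le1\}$. A stochastic kernel $Q$ on $\mathbb R$ is increasing if $x\le x'$ implies $\int g(y)\,Q(x,dy)\le\int g(y)\,Q(x',dy)$ for all $g\in ib\mathbb R$. For a kernel $P$, $(\phi P)(B)=\int P(x,B)\phi(dx)$ and $P^t$ is the $t$-step kernel. $P$ is globally stable on $(\mathcal P(\mathbb R),\beta)$ if there is a unique $\phi^*\in\mathcal P(\mathbb R)$ with $\phi^*P=\phi^*$, and $\beta(\phi P^t,\phi^* )\to0$ as $t\to\infty$ for all $\phi\in\mathcal P(\mathbb R)$. *)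

(* Defs.v *)
From HB Require Import structures.
From mathcomp Require Import all_boot all_order all_algebra.
From mathcomp Require Import all_classical all_reals all_analysis.
From mathcomp Require Import measurable_realfun.
From mathcomp Require Import ring.

Set Implicit Arguments.
Unset Strict Implicit.
Unset Printing Implicit Defensive.
Import Order.TTheory GRing.Theory Num.Theory.
Import numFieldNormedType.Exports.
Local Open Scope classical_set_scope.
Local Open Scope ring_scope.

Section markov_kernels.
Context d (X : measurableType d) (R : realType).

(* The library gives [P x] only a measure structure. *)
Definition kernel_law (P : R.-pker X ~> X) (x : X) : set X -> \bar R := P x.

HB.instance Definition _ (P : R.-pker X ~> X) (x : X) :=
  Measure.on (kernel_law P x).

HB.instance Definition _ (P : R.-pker X ~> X) (x : X) :=
  Measure_isProbability.Build _ _ _ (kernel_law P x) (prob_kernel x).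

(* The left action [phi P] of the kernel [P] on the law [phi]. *)
Definition kernel_push (phi : probability X R) (P : R.-pker X ~> X)
  (B : set X) : \bar R := (\int[phi]_x P x B)%E.

Section kernel_push.
Variables (phi : probability X R) (P : R.-pker X ~> X).

Let kernel_push0 : kernel_push phi P set0 = 0%E.
Proof. by apply: integral0_eq => x _; rewrite measure0. Qed.

Let kernel_push_ge0 B : (0 <= kernel_push phi P B)%E.
Proof. by apply: integral_ge0 => x _; exact: measure_ge0. Qed.

Let kernel_push_sigma_additive : semi_sigma_additive (kernel_push phi P).
Proof.
move=> F mF tF mUF; rewrite /kernel_push.
rewrite [X in _ --> X](_ : _ = (\sum_(n <oo) \int[phi]_x P x (F n))%E).
  apply/cvg_closeP; split; last by rewrite closeE.
  by apply: is_cvg_nneseries => *; exact: integral_ge0.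
rewrite -integral_nneseries//; last by move=> n; exact: measurable_kernel.
apply: eq_integral => x _; apply/esym/cvg_lim => //.
exact: measure_semi_sigma_additive.
Qed.

HB.instance Definition _ := isMeasure.Build _ _ _ (kernel_push phi P)
  kernel_push0 kernel_push_ge0 kernel_push_sigma_additive.

Let kernel_pushT : kernel_push phi P setT = 1%E.
Proof.
rewrite /kernel_push (eq_integral (cst 1%E)) => [|x _]; last first.
  by rewrite prob_kernel.
by rewrite integral_cst// mul1e; exact: probability_setT.
Qed.

HB.instance Definition _ :=
  Measure_isProbability.Build _ _ _ (kernel_push phi P) kernel_pushT.

End kernel_push.

Section kernel_comp.
Variables P Q : R.-pker X ~> X.

Definition kernel_comp : X -> {measure set X -> \bar R} := mkcomp_noparam P Q.

HB.instance Definition _ := Kernel.on kernel_comp.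

Let kernel_compT x : kernel_comp x setT = 1%E.
Proof.
rewrite /kernel_comp/= /kcomp_noparam (eq_integral (cst 1%E)) => [|y _].
  by rewrite integral_cst// prob_kernel mul1e.
by rewrite prob_kernel.
Qed.

HB.instance Definition _ :=
  Kernel_isProbability.Build _ _ _ _ _ kernel_comp kernel_compT.

End kernel_comp.

Fixpoint kernel_iter (P : R.-pker X ~> X) (t : nat) : R.-pker X ~> X :=
  if t is t'.+1 then kernel_comp (kernel_iter P t') P
  else kdirac (@measurable_id _ X setT).

End markov_kernels.

Section global_stability.
Context (R : realType).

Definition ibfun : set (R -> R) :=
  [set h : R -> R | [/\ {homo h : x y / x <= y}, measurable_fun setT h
             & exists M, forall x, `|h x| <= M]].

Definition beta_dist (phi psi : probability R R) : R :=
  sup [set `|\int[phi]_x h x - \int[psi]_x h x| |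
       h in [set h : R -> R | ibfun h /\ forall x, `|h x| <= 1]].

Definition increasing_kernel (Q : R.-pker R ~> R) :=
  forall g, ibfun g ->
  forall x x', x <= x' -> \int[Q x]_y g y <= \int[Q x']_y g y.

(* Borel measures are compared on Borel sets: a library measure also carries
   irrelevant values on the other sets. *)
Definition same_law (phi psi : probability R R) :=
  forall B, measurable B -> phi B = psi B.

Definition globally_stable (P : R.-pker R ~> R) :=
  exists phistar : probability R R,
    [/\ same_law (kernel_push phistar P) phistar,
        forall psi : probability R R,
          same_law (kernel_push psi P) psi -> same_law psi phistar
      & forall phi : probability R R,
          beta_dist (kernel_push phi (kernel_iter P t)) phistar
            @[t --> \oo] --> (0 : R)].

End global_stability.

Section likelihood_ratio.
Context d (T : measurableType d) (R : realType).

Definition is_density (mu : {measure set T -> \bar R}) (f : {mfun T >-> R}) :=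
  (forall z, 0 <= f z) /\ (\int[mu]_z (f z)%:E = 1)%E.

(* In the extended reals [r / 0] is [+oo] for [r > 0]: the ratio is infinite
   where only the second density vanishes, and so is its logarithm.  Its value
   [0] where both vanish is irrelevant, a null event under either density. *)
Definition likelihood_ratio (fh fl : T -> R) (z : T) : \bar R :=
  ((fh z)%:E / (fl z)%:E)%E.

End likelihood_ratio.

(* A finite variance presupposes that the variable is almost surely finite.
   The library variance of a nonintegrable variable is [+oo]. *)
Definition finite_variance d (T : measurableType d) (R : realType)
    (Pr : probability T R) (X : T -> \bar R) :=
  {ae Pr, forall w, X w \is a fin_num} /\ ('V_Pr[fine \o X] < +oo)%E.

Section log_likelihood.
Context d d' (T : measurableType d) (Omega : measurableType d') (R : realType).

Definition log_likelihood (fh fl : T -> R) (Z : Omega -> T) (w : Omega) :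
  \bar R := lne (likelihood_ratio fh fl (Z w)).

(* [fine] replaces the infinite values by 0; they have probability zero under
   [finite_variance]. *)
Definition log_likelihood_shock (fh fl : T -> R) (Z : Omega -> T) : Omega -> R :=
  fine \o log_likelihood fh fl Z.

Let measurable_lne : measurable_fun [set: \bar R] (@lne R).
Proof.
rewrite (_ : @lne R = fun x => if x \is a fin_num then
    (if (fine x <= 0)%R then -oo else (ln (fine x))%:E) else x)%E; last first.
  by apply/funext => -[].
apply: measurable_fun_ifT => //=.
  by apply: (measurable_fun_bool true); exact/emeasurable_fin_num.
apply: measurable_fun_ifT => //=; first exact: measurable_fun_ler.
by apply/measurable_EFinP; apply: measurableT_comp => //; exact: measurable_ln.
Qed.

Let measurable_inve_EFin : measurable_fun [set: R] (fun x => (x%:E^-1)%E).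
Proof.
rewrite (_ : (fun _ => _) = fun x : R =>
    if x == 0 then +oo%E else (x * (x ^+ 2) `^ (-1))%:E); last first.
  apply/funext => x; rewrite inver; case: eqP => // /eqP x0.
  by rewrite powR_inv1 ?sqr_ge0// expr2 invfM mulVKf.
apply: measurable_fun_ifT => //=; first exact: measurable_fun_eqr.
apply/measurable_EFinP/measurable_funM => //.
by apply: (measurableT_comp (measurable_powR _)); exact: measurable_funX.
Qed.

Variables (fh fl : {mfun T >-> R}) (Z : {mfun Omega >-> T}).

Lemma measurable_log_likelihood : measurable_fun setT (log_likelihood fh fl Z).
Proof.
apply: measurableT_comp => //.
apply: (measurableT_comp (f := likelihood_ratio fh fl)) => //.
apply: emeasurable_funM; first exact/measurable_EFinP.
exact: (measurableT_comp measurable_inve_EFin).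
Qed.

Let measurable_log_likelihood_shock :
  measurable_fun setT (log_likelihood_shock fh fl Z).
Proof.
by apply: measurableT_comp => //; exact: measurable_log_likelihood.
Qed.

HB.instance Definition _ := isMeasurableFun.Build _ _ _ _
  (log_likelihood_shock fh fl Z) measurable_log_likelihood_shock.

End log_likelihood.

Section belief_shock_kernel.
Context (R : realType).

Definition belief_update (x : R) (s : bool * (R * R)) : R :=
  s.1%:R * s.2.1 + (1 - s.1%:R) * (x + s.2.2).

Lemma belief_updateE x b r xi :
  belief_update x (b, (r, xi)) = if b then r else x + xi.
Proof. by case: b; rewrite /belief_update/=; ring. Qed.

Let measurable_belief_update x : measurable_fun setT (belief_update x).
Proof.
rewrite (_ : belief_update x = fun s => if s.1 then s.2.1 else x + s.2.2).
  apply: measurable_fun_ifT => //=.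
    exact: (measurableT_comp measurable_fst).
  by apply: measurable_funD => //; exact: (measurableT_comp measurable_snd).
by apply/funext => -[b [r xi]]; rewrite belief_updateE.
Qed.

HB.instance Definition _ x :=
  isMeasurableFun.Build _ _ _ _ (belief_update x) (measurable_belief_update x).

Variables (rho : R) (Q : R.-pker R ~> R) (nu : probability R R).

(* The law of [eta_{t+1}] given [eta_t = x]: the shocks are independent, with
   [I] Bernoulli(rho), [R] of law [Q x] and [xi] of law [nu]. *)
Definition belief_kernel (x : R) : {measure set R -> \bar R} :=
  distribution (bernoulli_prob rho \x (kernel_law Q x \x nu))%E
    (belief_update x).

Let xsection_true x (B : set R) : measurable B ->
  (kernel_law Q x \x nu)%E (xsection (belief_update x @^-1` B) true) = Q x B.
Proof.
move=> mB; rewrite (_ : xsection _ _ = B `*` setT); last first.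
  apply/seteqP; split=> -[r xi]; rewrite /xsection/= inE/= belief_updateE//.
  by case.
rewrite product_measure1E//; transitivity (Q x B * 1)%E; last exact: mule1.
by congr (_ * _)%E; exact: probability_setT.
Qed.

Let xsection_false x (B : set R) : measurable B ->
  (kernel_law Q x \x nu)%E (xsection (belief_update x @^-1` B) false) =
  nu [set y | B (x + y)%R].
Proof.
move=> mB; rewrite (_ : xsection _ _ = setT `*` [set y | B (x + y)]).
  have mxB : measurable [set y | B (x + y)].
    rewrite -[X in measurable X]setTI.
    exact: (measurable_funD (measurable_cst x) (@measurable_id _ R setT)).
  rewrite product_measure1E//.
  transitivity (1 * nu [set y | B (x + y)%R])%E; last exact: mul1e.
  by congr (_ * _)%E; exact: prob_kernel.
apply/seteqP; split=> -[r xi]; rewrite /xsection/= inE/= belief_updateE//.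
by case.
Qed.

Let measurable_translate (B : set R) : measurable B ->
  measurable_fun setT (fun x : R => nu [set y | B (x + y)%R]).
Proof.
move=> mB; pose A := [set xy : R * R | B (xy.1 + xy.2)].
have mA : measurable A.
  rewrite -[X in measurable X]setTI.
  exact: (measurable_funD measurable_fst measurable_snd).
rewrite (_ : (fun _ => _) = nu \o xsection A).
  exact: measurable_fun_xsection.
apply/funext => x /=; congr (nu _).
by apply/seteqP; split=> y; rewrite /xsection/= inE.
Qed.

Lemma belief_kernelE x (B : set R) : 0 <= rho <= 1 -> measurable B ->
  belief_kernel x B =
    (rho%:E * Q x B + (1 - rho)%:E * nu [set y | B (x + y)%R])%E.
Proof.
move=> rho01 mB; rewrite /belief_kernel/= /distribution /pushforward.
rewrite [LHS]integral_bernoulli_prob//=.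
by rewrite (xsection_true _ mB) (xsection_false _ mB).
Qed.

Let measurable_belief_kernel (B : set R) : measurable B ->
  measurable_fun setT (belief_kernel ^~ B).
Proof.
move=> mB; have [rho01|rho01] := boolP (0 <= rho <= 1); last first.
  rewrite (_ : belief_kernel ^~ B = fun x : R => nu [set y | B (x + y)%R]).
    exact: measurable_translate.
  apply/funext => x; rewrite /belief_kernel/= /distribution /pushforward.
  rewrite /product_measure1 (_ : bernoulli_prob rho = \d_false).
    by rewrite integral_dirac//= diracT mul1e; exact: xsection_false.
  by apply/funext => A; rewrite /bernoulli_prob (negbTE rho01).
rewrite (_ : belief_kernel ^~ B = fun x =>
    (rho%:E * Q x B + (1 - rho)%:E * nu [set y | B (x + y)%R])%E); last first.
  by apply/funext => x; exact: belief_kernelE.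
apply: emeasurable_funD; apply: emeasurable_funM => //.
  exact: measurable_kernel.
exact: measurable_translate.
Qed.

HB.instance Definition _ :=
  isKernel.Build _ _ _ _ _ belief_kernel measurable_belief_kernel.

Let belief_kernelT x : belief_kernel x setT = 1%E.
Proof. exact: probability_setT. Qed.

HB.instance Definition _ :=
  Kernel_isProbability.Build _ _ _ _ _ belief_kernel belief_kernelT.

End belief_shock_kernel.

(* Main.v *)
Require Import Defs.
From HB Require Import structures.
From mathcomp Require Import all_boot all_order all_algebra.
From mathcomp Require Import all_classical all_reals all_analysis.
From mathcomp Require Import measurable_realfun.
From mathcomp Require Import giry.
From mathcomp Require Import ring lra.

(** The belief shock kernel is globally stable because two of its steps contract
    the distance [beta], for which the space of laws is complete.

    Contraction. Since [Q] is increasing and a translation preserves order, the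
    belief shock kernel [P] is increasing; it maps the increasing test functions
    of [beta] to increasing functions and so never increases [beta]
    ([beta_dist_push_le]). Moreover two steps of [P] satisfy the splitting
    condition: there are a level [k] and a mass [c > 0] such that from every
    starting point the chain ends above [k] with probability at least [c] and
    below [k] with probability at least [c] ([splits_belief_kernel]). Indeed
    tightness of [Q] gives an interval [[-k, k]] that carries half of each
    [Q x], so a reset lands in it with probability at least [rho / 2]; a reset
    at the second step ends below [k], while a reset at the first step followed
    by a log-likelihood above [2 k] ends above [k]. The latter has positive
    probability because the likelihood ratio is unbounded and its logarithm is
    almost surely finite. Splitting squeezes the mean of an increasing test
    function [h] towards [h k] from both sides, so that the oscillation of the
    image of [h] shrinks by the factor [1 - c] ([splits_kernel_fun]), and hence
    so does [beta] ([beta_dist_push_contract]).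

    Completeness. Indicators of upper rays are test functions, so [beta] bounds
    the Kolmogorov distance between distribution functions. Conversely, the
    layer-cake formula writes the mean of an increasing function as an integral
    of masses of upper sets, which gives [beta] at most twice the Kolmogorov
    distance ([beta_dist_kolmogorov]). A Cauchy sequence of laws thus has
    uniformly convergent distribution functions, and the limit defines a
    Stieltjes probability to which the sequence converges in [beta]
    ([beta_dist_complete]).

    The iterates of [P] from any law are then a Cauchy sequence, whose limit is
    the unique invariant law ([splitting_globally_stable]). *)

Set Implicit Arguments.
Unset Strict Implicit.
Unset Printing Implicit Defensive.
Import Order.TTheory GRing.Theory Num.Theory.
Import numFieldNormedType.Exports.
Local Open Scope classical_set_scope.
Local Open Scope ring_scope.

(** * Integrals of bounded functions against probability measures *)

Section bounded_integrals.
Context d (T : measurableType d) (R : realType).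
Implicit Types (mu : probability T R) (h : T -> R).

Lemma prob_bounded_integrable mu h M : measurable_fun setT h ->
  (forall x, `|h x| <= M) -> mu.-integrable setT (EFin \o h).
Proof.
move=> mh hM; apply: measurable_bounded_integrable => //.
  by rewrite (le_lt_trans (probability_le1 _ _))// ltry.
exists M; split; first by rewrite num_real.
by move=> y My x _ /=; rewrite (le_trans (hM x))// ltW.
Qed.

Lemma Rintegral_prob_cst mu (r : R) : \int[mu]_x r = r.
Proof. by rewrite Rintegral_cst//= probability_setT mulr1. Qed.

Lemma Rintegral_prob_le mu h M : measurable_fun setT h ->
  (forall x, `|h x| <= M) -> `|\int[mu]_x h x| <= M.
Proof.
move=> mh hM.
have ih := prob_bounded_integrable mu mh hM.
apply: (le_trans (le_normr_Rintegral measurableT ih)).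
rewrite -[leRHS](Rintegral_prob_cst mu); apply: le_Rintegral => //.
  apply: (@prob_bounded_integrable _ _ M); first exact: measurableT_comp.
  by move=> x; rewrite normr_id.
exact: finite_measure_integrable_cst.
Qed.

Lemma RintegralD_cst mu h M (r : R) : measurable_fun setT h ->
  (forall x, `|h x| <= M) -> \int[mu]_x (h x + r) = \int[mu]_x h x + r.
Proof.
move=> mh hM; rewrite RintegralD//.
- by rewrite Rintegral_prob_cst.
- exact: prob_bounded_integrable hM.
- exact: finite_measure_integrable_cst.
Qed.

Lemma Rintegral_affine mu h M (r s : R) : measurable_fun setT h ->
  (forall x, `|h x| <= M) ->
  \int[mu]_x (r * h x + s) = r * \int[mu]_x h x + s.
Proof.
move=> mh hM; have ih := prob_bounded_integrable mu mh hM.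
rewrite (@RintegralD_cst _ _ (`|r| * M)).
- by rewrite RintegralZl.
- exact: measurable_funM.
- by move=> x; rewrite normrM ler_wpM2l.
Qed.

Lemma Rintegral_indic_prob mu (A : set T) : measurable A ->
  \int[mu]_x \1_A x = fine (mu A).
Proof. by move=> mA; rewrite /Rintegral integral_indic// setIT. Qed.

Lemma EFin_Rintegral_prob mu h M : measurable_fun setT h ->
  (forall x, `|h x| <= M) -> (\int[mu]_x h x)%:E = (\int[mu]_x (h x)%:E)%E.
Proof.
move=> mh hM; rewrite /Rintegral fineK//; apply: integrable_fin_num => //.
exact: prob_bounded_integrable hM.
Qed.

(** A bounded function shifted by its bound is nonnegative and still bounded:
    this transfers identities proved for nonnegative extended integrals to the
    real integrals of bounded functions. *)
Lemma bounded_shift_ge0 h M x : (forall y, `|h y| <= M) -> 0 <= h x + M.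
Proof.
move=> hM; rewrite -lerBlDr sub0r.
by have := hM x; rewrite ler_norml => /andP[].
Qed.

Lemma bounded_shift_le h M x : (forall y, `|h y| <= M) ->
  `|h x + M| <= M + M.
Proof.
move=> hM; rewrite (le_trans (ler_normD _ _))// lerD//.
by rewrite ger0_norm// (le_trans _ (hM x)).
Qed.

Lemma normr_indic_le1 (A : set T) x : `|\1_A x : R| <= 1.
Proof. by rewrite indicE ger0_norm// lern1 leq_b1. Qed.

End bounded_integrals.

Lemma eq_law_Rintegral d (T : measurableType d) (R : realType)
    (mu nu : {measure set T -> \bar R}) (h : T -> R) :
  (forall B, measurable B -> mu B = nu B) -> \int[mu]_x h x = \int[nu]_x h x.
Proof.
by move=> e; congr fine; apply: eq_measure_integral => A mA _; exact: e.
Qed.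

(** * Markov kernels acting on functions and on laws *)

Section kernel_integrals.
Context d (X : measurableType d) (R : realType).
Implicit Types (P K : R.-pker X ~> X) (phi : probability X R) (h : X -> R).

Definition kernel_fun P h (x : X) : R := \int[P x]_y h y.

(** The same integral, against a measure known to be a probability, so that the
    lemmas of the first part apply. *)
Lemma kernel_fun_law P h x : kernel_fun P h x = \int[kernel_law P x]_y h y.
Proof. by []. Qed.

Lemma kernel_fun_le P h M x : measurable_fun setT h ->
  (forall x, `|h x| <= M) -> `|kernel_fun P h x| <= M.
Proof. by move=> mh hM; rewrite kernel_fun_law; exact: Rintegral_prob_le. Qed.

Lemma measurable_kernel_fun P h M : measurable_fun setT h ->
  (forall x, `|h x| <= M) -> measurable_fun setT (kernel_fun P h).
Proof.
move=> mh hM.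
have M0 x := bounded_shift_ge0 x hM.
have mhM : measurable_fun setT (fun x => h x + M) by exact: measurable_funD.
have E x : kernel_fun P h x = \int[P x]_y (h y + M) - M.
  apply/esym/(canLR (addrK M)).
  exact: (RintegralD_cst (kernel_law P x) M mh hM).
rewrite (_ : kernel_fun P h = fun x => \int[P x]_y (h y + M) - M); last first.
  exact/funext.
apply: measurable_funB => //; apply: measurableT_comp => //.
apply: measurable_fun_integral_kernel.
- by move=> U mU; exact: measurable_kernel.
- by move=> y; rewrite lee_fin.
- exact/measurable_EFinP.
Qed.

(** A kernel is a measurable map into the space of laws, and the law [phi P] is
    the bind of the Giry monad, whose integral is already an iterated one. *)
Lemma ge0_integral_kernel_push phi P (f : X -> \bar R) :
  measurable_fun setT f -> (forall x, (0 <= f x)%E) ->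
  (\int[kernel_push phi P]_x f x = \int[phi]_x \int[P x]_y f y)%E.
Proof.
move=> mf f0.
pose k (x : X) : giry X R := kernel_law P x.
have mk : measurable_fun setT k.
  apply: measurable_giry_codensity => // B mB.
  exact: (measurable_kernel P B mB).
rewrite -[RHS](giry_int_bind phi mk mf f0) /giry_int.
apply: eq_measure_integral => A mA _; rewrite /=.
rewrite /giry_int ge0_integral_pushforward//=.
exact: measurable_giry_ev.
Qed.

Lemma Rintegral_kernel_push phi P h M : measurable_fun setT h ->
  (forall x, `|h x| <= M) ->
  \int[kernel_push phi P]_x h x = \int[phi]_x kernel_fun P h x.
Proof.
move=> mh hM.
have M0 x := bounded_shift_ge0 x hM.
have mhM : measurable_fun setT (fun x => h x + M) by exact: measurable_funD.
apply: (@addIr _ M).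
rewrite -(RintegralD_cst _ _ mh hM).
rewrite -(@RintegralD_cst _ _ _ phi (kernel_fun P h) M); last 2 first.
- exact: measurable_kernel_fun mh hM.
- by move=> x; exact: kernel_fun_le.
rewrite {1}/Rintegral ge0_integral_kernel_push; last 2 first.
- exact/measurable_EFinP.
- by move=> x; rewrite lee_fin.
congr fine; apply: eq_integral => x _.
have bM y := bounded_shift_le y hM.
rewrite -(EFin_Rintegral_prob (kernel_law P x) mhM bM).
by rewrite (RintegralD_cst _ _ mh hM).
Qed.

Lemma kernel_push_eq phi (psi : probability X R) P :
  (forall B, measurable B -> phi B = psi B) ->
  forall B : set X, kernel_push phi P B = kernel_push psi P B.
Proof.
by move=> e B; apply: eq_measure_integral => A mA _; exact: e.
Qed.

Lemma kernel_push_comp phi K P B : measurable B ->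
  kernel_push phi (kernel_comp K P) B = kernel_push (kernel_push phi K) P B.
Proof.
move=> mB; rewrite [RHS]/kernel_push ge0_integral_kernel_push//.
exact: measurable_kernel.
Qed.

Lemma kernel_push_iter0 phi P B : measurable B ->
  kernel_push phi (kernel_iter P 0) B = phi B.
Proof.
move=> mB; rewrite /kernel_push /= /kdirac.
by rewrite (eq_integral (fun x => (\1_B x)%:E)) ?integral_indic ?setIT.
Qed.

(** Chapman-Kolmogorov, for the action on laws. *)
Lemma kernel_push_iterD phi P m n B : measurable B ->
  kernel_push phi (kernel_iter P (m + n)) B =
  kernel_push (kernel_push phi (kernel_iter P m)) (kernel_iter P n) B.
Proof.
elim: n B => [|n IH] B mB.
  by rewrite addn0 kernel_push_iter0.
rewrite addnS/= !kernel_push_comp//.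
by apply: kernel_push_eq => A mA; exact: IH.
Qed.

Lemma kernel_fun_iter0 P h x : measurable_fun setT h ->
  kernel_fun (kernel_iter P 0) h x = h x.
Proof.
move=> mh; rewrite /kernel_fun /Rintegral integral_dirac ?diracT ?mul1e//.
exact/measurable_EFinP.
Qed.

Lemma kernel_fun_comp K P h M x : measurable_fun setT h ->
  (forall x, `|h x| <= M) ->
  kernel_fun (kernel_comp K P) h x = kernel_fun K (kernel_fun P h) x.
Proof.
move=> mh hM.
rewrite kernel_fun_law [RHS]kernel_fun_law -(Rintegral_kernel_push _ _ mh hM).
exact: eq_law_Rintegral.
Qed.

Lemma kernel_fun_indic P (A : set X) x : measurable A ->
  kernel_fun P \1_A x = fine (P x A).
Proof. by move=> mA; rewrite kernel_fun_law Rintegral_indic_prob. Qed.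

End kernel_integrals.

(** * The distance [beta] and the contraction given by splitting *)

Section beta_distance.
Context (R : realType).
Implicit Types (phi psi : probability R R) (h g : R -> R).
Implicit Types (P : R.-pker R ~> R).

Lemma beta_dist_lb phi psi h : ibfun h -> (forall x, `|h x| <= 1) ->
  `|\int[phi]_x h x - \int[psi]_x h x| <= beta_dist phi psi.
Proof.
move=> ih h1; apply: sup_ubound; last by exists h.
exists (1 + 1) => _ [g [[_ mg _] g1] <-].
by rewrite (le_trans (ler_normB _ _))// lerD// Rintegral_prob_le.
Qed.

Lemma beta_dist_ub phi psi (r : R) :
  (forall h, ibfun h -> (forall x, `|h x| <= 1) ->
    `|\int[phi]_x h x - \int[psi]_x h x| <= r) ->
  beta_dist phi psi <= r.
Proof.
move=> H; apply: ge_sup; last by move=> _ [g [ig g1] <-]; exact: H.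
exists `|\int[phi]_x (cst 0 x) - \int[psi]_x (cst 0 x)|; exists (cst 0) => //.
split; last by move=> x; rewrite normr0.
by split=> //; exists 0 => x; rewrite normr0.
Qed.

Lemma beta_dist_ge0 phi psi : 0 <= beta_dist phi psi.
Proof.
apply: le_trans (@beta_dist_lb phi psi (cst 0) _ _) => //.
  by split=> //; exists 0 => x; rewrite normr0.
by move=> x; rewrite normr0.
Qed.

Lemma beta_dist_le2 phi psi : beta_dist phi psi <= 2.
Proof.
apply: beta_dist_ub => h [_ mh _] h1.
rewrite (le_trans (ler_normB _ _))// -[leRHS]/(1 + 1).
by rewrite lerD// Rintegral_prob_le.
Qed.

Lemma beta_distC phi psi : beta_dist phi psi = beta_dist psi phi.
Proof.
by apply/eqP; rewrite eq_le; apply/andP; split; apply: beta_dist_ub => h ih h1;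
  rewrite distrC; exact: beta_dist_lb.
Qed.

Lemma beta_dist_triangle chi phi psi :
  beta_dist phi psi <= beta_dist phi chi + beta_dist chi psi.
Proof.
apply: beta_dist_ub => h ih h1.
by rewrite (le_trans (ler_distD (\int[chi]_x h x) _ _))// lerD// beta_dist_lb.
Qed.

Lemma beta_dist_same_law phi phi' psi psi' :
  same_law phi phi' -> same_law psi psi' ->
  beta_dist phi psi = beta_dist phi' psi'.
Proof.
move=> e e'; congr sup; apply: eq_imagel => h _.
by rewrite (eq_law_Rintegral h e) (eq_law_Rintegral h e').
Qed.

Lemma beta_dist_scale phi psi g (M : R) : 0 < M -> ibfun g ->
  (forall x, `|g x| <= M) ->
  `|\int[phi]_x g x - \int[psi]_x g x| <= M * beta_dist phi psi.
Proof.
move=> M0 [ig mg _] gM.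
have E (m : probability R R) : \int[m]_x g x = M * \int[m]_x (M^-1 * g x).
  rewrite RintegralZl// ?mulVKf ?gt_eqF//.
  exact: prob_bounded_integrable mg gM.
have g1 x : `|M^-1 * g x| <= 1.
  by rewrite normrM gtr0_norm ?invr_gt0// ler_pdivrMl// mulr1.
rewrite (E phi) (E psi) -mulrBr normrM gtr0_norm// ler_pM2l//.
apply: beta_dist_lb => //; split.
- by move=> x y xy; rewrite ler_pM2l ?invr_gt0//; exact: ig.
- exact: measurable_funM.
- by exists 1.
Qed.

Lemma ibfun_ray (x : R) : ibfun (\1_`]x, +oo[ : R -> R).
Proof.
split.
- move=> y z yz; rewrite !indicE ler_nat; case: (boolP (y \in _)) => //.
  rewrite !inE/= !in_itv/= !andbT => xy.
  by rewrite mem_set//= in_itv/= andbT (lt_le_trans xy).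
- exact: measurable_indic.
- by exists 1 => y; exact: normr_indic_le1.
Qed.

Lemma beta_dist_ray phi psi (x : R) :
  `|fine (phi `]x, +oo[%classic) - fine (psi `]x, +oo[%classic)|
    <= beta_dist phi psi.
Proof.
rewrite -!Rintegral_indic_prob//; apply: beta_dist_lb.
  exact: ibfun_ray.
by move=> y; exact: normr_indic_le1.
Qed.

Lemma ibfun_kernel_fun P h : increasing_kernel P -> ibfun h ->
  ibfun (kernel_fun P h).
Proof.
move=> iP ih; have [_ mh [M hM]] := ih; split.
- by move=> x y; exact: iP.
- exact: measurable_kernel_fun mh hM.
- by exists M => x; exact: kernel_fun_le.
Qed.

Lemma increasing_kernel_iter P n : increasing_kernel P ->
  increasing_kernel (kernel_iter P n).
Proof.
move=> iP; elim: n => [|n IH] g ig x y xy; have [mono mg [M gM]] := ig.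
  have E z := kernel_fun_iter0 P z mg.
  rewrite /kernel_fun in E.
  by rewrite !E; exact: mono.
have E z := kernel_fun_comp (kernel_iter P n) P z mg gM.
rewrite /kernel_fun in E.
rewrite /= !E; apply: IH => //.
exact: ibfun_kernel_fun.
Qed.

(** An increasing kernel maps the test functions of [beta] to test functions, so
    it cannot increase the distance. *)
Lemma beta_dist_push_le phi psi P : increasing_kernel P ->
  beta_dist (kernel_push phi P) (kernel_push psi P) <= beta_dist phi psi.
Proof.
move=> iP; apply: beta_dist_ub => h ih h1; have [_ mh _] := ih.
rewrite !(Rintegral_kernel_push _ _ mh h1); apply: beta_dist_lb.
  exact: ibfun_kernel_fun.
by move=> x; exact: kernel_fun_le.
Qed.

(** The splitting condition of Dubins and Freedman for monotone chains. *)
Definition splits P (k c : R) := forall x,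
  c <= fine (P x `]k, +oo[%classic) /\ c <= fine (P x `]-oo, k]%classic).

(** An increasing [h] with values in [[-1, 1]] is at least [h k] above [k] and
    at most [h k] below; a mass [c] of [P x] on either side therefore pulls the
    mean of [h] towards [h k] from both sides, uniformly in [x]. *)
Lemma splits_kernel_fun P (k c : R) h x : splits P k c -> ibfun h ->
  (forall x, `|h x| <= 1) -> `|kernel_fun P h x - c * h k| <= 1 - c.
Proof.
move=> sP [ih mh _] h1.
have [up lo] := sP x.
have hk : -1 <= h k <= 1 by rewrite -ler_norml.
have il (A : set R) (r s : R) : measurable A ->
    (kernel_law P x).-integrable setT (EFin \o (fun y => r * \1_A y + s)).
  move=> mA; apply: (@prob_bounded_integrable _ _ _ _ _ (`|r| + `|s|)).
    by apply: measurable_funD => //; apply: measurable_funM.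
  move=> y; rewrite (le_trans (ler_normD _ _))// lerD// normrM.
  by rewrite ler_piMr// normr_indic_le1.
have ih' : (kernel_law P x).-integrable setT (EFin \o h).
  exact: prob_bounded_integrable mh h1.
have E (A : set R) (r s : R) : measurable A ->
    \int[kernel_law P x]_y (r * \1_A y + s) = r * fine (P x A) + s.
  move=> mA; rewrite (@Rintegral_affine _ _ _ _ _ 1).
  - by rewrite Rintegral_indic_prob.
  - exact: measurable_indic.
  - by move=> y; exact: normr_indic_le1.
(* [h] lies above [h k] on the upper ray and above [-1] elsewhere. *)
have lb : (h k + 1) * fine (P x `]k, +oo[%classic) - 1 <= kernel_fun P h x.
  rewrite -E// kernel_fun_law; apply: le_Rintegral => //.
    exact: il.
  move=> y _; rewrite indicE; have := h1 y; rewrite ler_norml => /andP[hy _].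
  case: (boolP (y \in _)); last by rewrite mulr0 add0r.
  rewrite inE/= in_itv/= andbT => ky; rewrite mulr1 addrK.
  exact/ih/ltW.
have ub : kernel_fun P h x <= (h k - 1) * fine (P x `]-oo, k]%classic) + 1.
  rewrite -E// kernel_fun_law; apply: le_Rintegral => //.
    exact: il.
  move=> y _; rewrite indicE; have := h1 y; rewrite ler_norml => /andP[_ hy].
  case: (boolP (y \in _)); last by rewrite mulr0 add0r.
  by rewrite inE/= in_itv/= => ky; rewrite mulr1 subrK; exact/ih.
rewrite ler_norml; apply/andP; split; nra.
Qed.

(** By [splits_kernel_fun], [P h] is, up to an additive constant, [1 - c] times
    a test function; the constant disappears in a difference of integrals. *)
Lemma beta_dist_push_contract phi psi P (k c : R) : c < 1 ->
  increasing_kernel P -> splits P k c ->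
  beta_dist (kernel_push phi P) (kernel_push psi P)
    <= (1 - c) * beta_dist phi psi.
Proof.
move=> c1 iP sP; apply: beta_dist_ub => h ih h1; have [_ mh _] := ih.
rewrite !(Rintegral_kernel_push _ _ mh h1).
have [mono mPh [M hM]] := ibfun_kernel_fun iP ih.
have B x := splits_kernel_fun x sP ih h1.
have := @beta_dist_scale phi psi
  (fun x => kernel_fun P h x + - (c * h k)) (1 - c).
rewrite !(RintegralD_cst _ _ mPh hM) opprD addrACA subrr addr0; apply => //.
- by rewrite subr_gt0.
- split.
  + by move=> x y xy; rewrite lerD2r; exact: mono.
  + exact: measurable_funD.
  + by exists (1 - c).
Qed.

Lemma beta_dist_contract_iter phi psi P (k c : R) (N q r : nat) : c < 1 ->
  increasing_kernel P -> splits (kernel_iter P N) k c ->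
  beta_dist (kernel_push phi (kernel_iter P (q * N + r)))
            (kernel_push psi (kernel_iter P (q * N + r)))
    <= (1 - c) ^+ q * beta_dist phi psi.
Proof.
move=> c1 iP sP; elim: q phi psi => [|q IH] phi psi.
  rewrite mul0n add0n expr0 mul1r.
  by apply: beta_dist_push_le; exact: increasing_kernel_iter.
have E (m : probability R R) := @kernel_push_iterD _ _ _ m P N (q * N + r).
rewrite mulSn -addnA (beta_dist_same_law (E phi) (E psi)).
rewrite (le_trans (IH _ _))// exprSr -mulrA ler_wpM2l//.
  by rewrite exprn_ge0// subr_ge0 ltW.
apply: beta_dist_push_contract c1 _ sP.
exact: increasing_kernel_iter.
Qed.

End beta_distance.

(** * Comparison of [beta] with the Kolmogorov distance *)

Section kolmogorov.
Context (R : realType).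
Implicit Types (phi psi : probability R R) (h : R -> R) (U : set R).

Lemma upper_set_cases U : (forall x y, x <= y -> U x -> U y) ->
  [\/ U = set0, U = setT, exists a, U = `]a, +oo[%classic
    | exists a, U = `[a, +oo[%classic].
Proof.
move=> up; have [->|U0] := eqVneq U set0; first by constructor 1.
have [bU|nbU] := pselect (has_lbound U); last first.
  constructor 2; rewrite -subTset => x _; apply: contrapT => nUx.
  by apply: nbU; exists x => y Uy; rewrite leNgt; apply/negP => /ltW yx;
    exact/nUx/(up y).
have iU : has_inf U by split=> //; exact/set0P.
have sub1 y : inf U < y -> U y.
  by move=> /(inf_lt iU.1)[z Uz /ltW zy]; exact: up Uz.
have sub2 y : U y -> inf U <= y by move=> Uy; apply: ge_inf.
have [Ui|nUi] := pselect (U (inf U)).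
  constructor 4; exists (inf U).
  apply/seteqP; split=> y /=; rewrite in_itv/= andbT.
    exact: sub2.
  by rewrite le_eqVlt => /predU1P[<-//|]; exact: sub1.
constructor 3; exists (inf U).
apply/seteqP; split=> y /=; rewrite in_itv/= andbT.
  move=> Uy; rewrite lt_neqAle sub2// andbT.
  by apply/eqP => yE; apply: nUi; rewrite yE.
exact: sub1.
Qed.

(** A closed ray is the intersection of a decreasing sequence of open ones, so
    bounds on the open rays extend to all upper sets. *)
Lemma kolmogorov_upper_set phi psi (r : R) U : 0 <= r ->
  (forall x, (phi `]x, +oo[%classic <= psi `]x, +oo[%classic + r%:E)%E) ->
  (forall x y, x <= y -> U x -> U y) -> (phi U <= psi U + r%:E)%E.
Proof.
move=> r0 H /upper_set_cases[->|->|[a ->]|[a ->]] //.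
- by rewrite !measure0 add0e lee_fin.
- by rewrite !probability_setT -EFinD lee_fin lerDl.
pose F (n : nat) : set R := `]a - n.+1%:R^-1, +oo[%classic.
have FE : `[a, +oo[%classic = \bigcap_n F n by rewrite itvcyEbigcap.
have cF : psi (F n) @[n --> \oo] --> psi `[a, +oo[%classic.
  rewrite FE; apply: (@nonincreasing_cvg_mu _ _ _ psi F) => //.
  - by apply: le_lt_trans (ltry 1); apply: probability_le1; rewrite /F.
  - by move=> i; rewrite /F.
  - by rewrite -FE.
  - move=> m n mn; apply/subsetPset => x; rewrite /F/= !in_itv/= !andbT.
    by apply: le_lt_trans; rewrite lerD2l lerN2 lef_pV2 ?posrE// ler_nat.
have cFr : (psi (F n) + r%:E)%E @[n --> \oo] -->
    (psi `[a, +oo[%classic + r%:E)%E.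
  apply: cvgeD => //; last exact: cvg_cst.
  by rewrite fin_num_adde_defl.
apply: (cvge_to_ge cFr); near=> n.
apply: le_trans (H _); apply: le_measure; rewrite ?inE//.
by apply: subset_itvr; rewrite bnd_simp ltrBlDr ltrDl.
Unshelve. all: by end_near. Qed.

(** By the layer-cake formula the mean of [h + 1] is the integral over [s >= 0]
    of the mass of the upper set [{h + 1 > s}]. The mass under [phi] exceeds the
    mass under [psi] by at most [r], and both vanish for [s > 2]. *)
Lemma kolmogorov_integral phi psi (r : R) h : 0 <= r ->
  (forall x, (phi `]x, +oo[%classic <= psi `]x, +oo[%classic + r%:E)%E) ->
  {homo h : x y / x <= y} -> (forall x, `|h x| <= 1) ->
  \int[phi]_x h x <= \int[psi]_x h x + 2 * r.
Proof.
move=> r0 H mono h1.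
have mh : measurable_fun setT h by exact: nondecreasing_measurable.
have mX : measurable_fun setT (fun x => h x + 1) by exact: measurable_funD.
pose X : {mfun R >-> R} := HB.pack (fun x => h x + 1)
  (isMeasurableFun.Build _ _ _ _ _ mX).
have X0 x : 0 <= X x by exact: bounded_shift_ge0.
have X2 x : X x <= 2.
  by rewrite (le_trans (ler_norm _))// bounded_shift_le.
have E (m : probability R R) :
    (\int[m]_x h x + 1)%:E = (\int[@lebesgue_measure R]_(s in `[0%R, +oo[)
       m (X @^-1` `]s, +oo[%classic))%E.
  rewrite -(RintegralD_cst _ _ mh h1).
  rewrite (EFin_Rintegral_prob m mX (M := 2)); last first.
    by move=> x; rewrite ger0_norm; [exact: X2|exact: X0].
  by rewrite -[LHS](@expectation_def _ _ _ m X) ge0_expectation_ccdf.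
rewrite -(lerD2r 1) (addrAC _ (2 * r)) -lee_fin [leRHS]EFinD !E.
have mU s : forall x y, x <= y -> X x > s -> X y > s.
  by move=> x y xy sx; rewrite (lt_le_trans sx)// lerD2r mono.
have mI (m : probability R R) :
    measurable_fun (`[0%R, +oo[%classic : set R)
      (fun s : measurableTypeR R => m (X @^-1` `]s, +oo[%classic)).
  by apply: measurable_funTS; exact: (@ccdf_measurable _ _ _ m X).
pose D : set R := `[0, 2]%classic.
have -> : (2 * r)%:E = (\int[@lebesgue_measure R]_(s in `[0%R, +oo[)
    (r * \1_D s)%:E)%E.
  under eq_integral do rewrite EFinM.
  rewrite ge0_integralZl//; last first.
    apply/measurable_EFinP/measurable_funTS/measurable_indic.
    exact: measurable_itv.
  rewrite integral_indic; [|exact: measurable_itv|exact: measurable_itv].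
  rewrite setIidl; last first.
    by move=> x; rewrite /D/= !in_itv/= => /andP[->].
  rewrite mulrC EFinM; congr (_ * _)%E; apply/esym.
  by rewrite [LHS]lebesgue_measure_itv/= lte_fin ltr0n/= oppr0 adde0.
have mD : measurable_fun (`[0%R, +oo[%classic : set R)
    (fun s : measurableTypeR R => (r * \1_D s)%:E).
  apply/measurable_EFinP/measurable_funTS/measurable_funM => //.
  by apply: measurable_indic; exact: measurable_itv.
have D0 s : (0 <= (r * \1_D s)%:E)%E by rewrite lee_fin mulr_ge0.
rewrite -ge0_integralD//; last exact: mI.
apply: ge0_le_integral => //.
- exact: mI.
- by apply: emeasurable_funD => //; exact: mI.
move=> s /=; rewrite in_itv/= andbT => s0.
have [s2|s2] := leP s 2.
  rewrite indicE mem_set ?mulr1; last by rewrite /D/= in_itv/= s0.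
  apply: kolmogorov_upper_set => // x y xy /=.
  by rewrite !in_itv/= !andbT; exact: mU.
rewrite (_ : _ @^-1` _ = set0); last first.
  rewrite -subset0 => x /=; rewrite in_itv/= andbT => sx.
  by have := X2 x; rewrite leNgt (lt_trans s2).
by rewrite !measure0 add0e lee_fin mulr_ge0.
Qed.

Lemma probability_ray_fin (m : probability R R) (x : R) :
  (fine (m `]x, +oo[%classic))%:E = m `]x, +oo[%classic.
Proof. by rewrite fineK// fin_num_measure. Qed.

Lemma beta_dist_kolmogorov phi psi (r : R) :
  (forall x,
    `|fine (phi `]x, +oo[%classic) - fine (psi `]x, +oo[%classic)| <= r) ->
  beta_dist phi psi <= 2 * r.
Proof.
move=> H; have r0 : 0 <= r by exact: le_trans (H 0).
apply: beta_dist_ub => h [mono _ _] h1.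
rewrite ler_distlC; apply/andP; split; rewrite ?lerBlDr;
  apply: kolmogorov_integral => // x;
  rewrite -(probability_ray_fin phi) -(probability_ray_fin psi) -EFinD lee_fin;
  by have := H x; rewrite ler_distlC ?lerBlDr => /andP[].
Qed.

Lemma same_law_rays phi psi :
  (forall x, phi `]x, +oo[%classic = psi `]x, +oo[%classic) ->
  same_law phi psi.
Proof.
move=> H B mB.
apply: (measure_unique (@RGenOInfty.G R)
  (fun n => `](- n%:R), +oo[%classic)) => //.
- exact: RGenOInfty.measurableE.
- move=> _ _ [x ->] [y ->]; exists (Num.max x y).
  by apply/seteqP; split=> z; rewrite /= !in_itv/= !andbT gt_max => /andP.
- by move=> n; exists (- n%:R).
- rewrite -subTset => x _; exists (Num.truncn (- x)).+1 => //=.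
  by rewrite in_itv/= andbT ltrNl truncnS_gt.
- by move=> _ [x ->]; exact: H.
- by move=> n; apply: le_lt_trans (ltry 1); exact: probability_le1.
Qed.

Lemma beta_dist_eq0 phi psi : beta_dist phi psi = 0 -> same_law phi psi.
Proof.
move=> b0; apply: same_law_rays => x.
rewrite -(probability_ray_fin phi) -(probability_ray_fin psi).
congr _%:E; apply/eqP.
by rewrite -subr_eq0 -normr_le0 -b0 beta_dist_ray.
Qed.

End kolmogorov.

(** * Completeness of [beta] *)

(** One interchange of limits serves the three properties of a distribution
    function that must pass to a uniform limit: right continuity, and the limits
    at the two infinities. *)
Lemma cvg_uniform_limit (R : realType) (F : set_system R) {FF : ProperFilter F}
    (G : nat -> R -> R) (g : R -> R) (l : nat -> R) (a : R) (e : nat -> R) :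
  e n @[n --> \oo] --> 0 ->
  (forall n x, `|G n x - g x| <= e n) -> (forall n, `|l n - a| <= e n) ->
  (forall n, G n x @[x --> F] --> l n) -> g x @[x --> F] --> a.
Proof.
move=> e0 Gg la Gl; apply/cvgrPdist_lt => eps eps0.
have e3 : 0 < eps / 3 by rewrite divr_gt0.
have /cvgrPdist_lt/(_ _ e3)[n _ /(_ n (leqnn n))] := e0.
rewrite /= sub0r normrN => en.
have {}en : e n < eps / 3 by rewrite (le_lt_trans _ en)// ler_norm.
near=> x.
have : `|l n - G n x| < eps / 3.
  by near: x; move: (Gl n) => /cvgrPdist_lt; exact.
have := Gg n x; have := la n.
rewrite !ler_norml !ltr_norml => /andP[? ?] /andP[? ?] /andP[? ?].
by apply/andP; split; lra.
Unshelve. all: by end_near. Qed.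

Section stieltjes.
Context (R : realType) (F : R -> R).
Hypothesis ndF : nondecreasing F.
Hypothesis rcF : right_continuous F.
Hypothesis F_Ny : F @ -oo --> (0 : R).
Hypothesis F_y : F @ +oo --> (1 : R).

#[local] HB.instance Definition _ := isCumulative.Build R _ R F ndF rcF.
#[local] HB.instance Definition _ := isCumulativeBounded.Build R 0 1 F F_Ny F_y.

Let idTR : measurableTypeR R -> R := idfun.
#[local] HB.instance Definition _ :=
  @isMeasurableFun.Build _ _ _ _ idTR (@measurable_id _ _ setT).

(** The Stieltjes measure lives on a copy of the line with another display; its
    image under the identity is a law on the line. *)
Lemma probability_of_cdf :
  exists phi : probability R R, forall x, phi `]-oo, x]%classic = (F x)%:E.
Proof.
pose lsf : probability (measurableTypeR R) R := lebesgue_stieltjes_measure F.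
exists (distribution lsf (idTR : {RV lsf >-> R})) => x.
exact: (cdf_lebesgue_stieltjes_id F x).
Qed.

End stieltjes.

Section completeness.
Context (R : realType).
Variables (mu : nat -> probability R R) (e : nat -> R).
Hypothesis e0 : e n @[n --> \oo] --> 0.
Hypothesis cauchy_mu : forall n m, beta_dist (mu n) (mu (n + m)%N) <= e n.

Let F n x := fine (mu n `]-oo, x]%classic).

Let FE n x : F n x = 1 - fine (mu n `]x, +oo[%classic).
Proof.
rewrite /F -setCitvr probability_setC// -(probability_ray_fin (mu n)).
by rewrite -EFinB.
Qed.

Let e_ge0 n : 0 <= e n.
Proof. exact: le_trans (beta_dist_ge0 _ _) (cauchy_mu n 0). Qed.

Let F_cauchy n m x : F n x - e n <= F m x + e m.
Proof.
have B i j : `|F i x - F (i + j)%N x| <= e i.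
  rewrite !FE opprB addrC addrA subrK distrC.
  exact: le_trans (beta_dist_ray _ _ _) (cauchy_mu _ _).
have en := e_ge0 n; have em := e_ge0 m.
have [/subnKC nm|/ltnW/subnKC nm] := leqP n m.
  by have := B n (m - n)%N; rewrite nm ler_norml => /andP[? ?]; lra.
by have := B m (n - m)%N; rewrite nm ler_norml => /andP[? ?]; lra.
Qed.

(** The pointwise limit of the distribution functions, written as a supremum:
    all the lower bounds [F n x - e n] lie below all the upper bounds
    [F m x + e m], so this number is within [e n] of [F n x]. *)
Let G x := sup [set F n x - e n | n in setT].

Let F_G n x : `|F n x - G x| <= e n.
Proof.
have ub : ubound [set F m x - e m | m in setT] (F n x + e n).
  by move=> _ [m _ <-].
rewrite ler_distl; apply/andP; split.
  rewrite lerBlDr; apply: ge_sup ub.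
  by exists (F 0 x - e 0), 0.
by rewrite -lerBlDr; apply: ub_le_sup; [exists (F n x + e n)|exists n].
Qed.

(** On the test functions that are indicators of rays, [beta] bounds the
    Kolmogorov distance, so the distribution functions converge uniformly. The
    limit is then itself a distribution function: uniformity of the convergence
    prevents mass from escaping to infinity. *)
Lemma beta_dist_complete :
  exists phi : probability R R, forall n, beta_dist (mu n) phi <= 2 * e n.
Proof.
have ndG : nondecreasing G.
  move=> x y xy; apply: ge_sup; first by exists (F 0 x - e 0), 0.
  move=> _ [n _ <-]; have := F_G n y.
  have : F n x <= F n y.
    by rewrite fine_le ?fin_num_measure// le_measure ?inE//; exact: subset_itvl.
  by rewrite ler_norml => ? /andP[? ?]; lra.
pose idR : {mfun R >-> R} := HB.pack (idfun : R -> R)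
  (isMeasurableFun.Build _ _ _ _ _ (@measurable_id _ R setT)).
have idE n : F n = fine \o cdf (idR : {RV mu n >-> R}) by [].
have rcF n : right_continuous (F n).
  move=> x; rewrite idE; apply: fine_cvg.
  by rewrite fineK ?fin_num_measure//; exact: cdf_right_continuous.
have rcG : right_continuous G.
  by move=> x; apply: (cvg_uniform_limit e0 F_G) => n; [exact: F_G|exact: rcF].
have G_Ny : G @ -oo --> (0 : R).
  apply: (cvg_uniform_limit (l := fun=> 0) e0 F_G) => n.
    by rewrite subrr normr0.
  by rewrite idE; apply: fine_cvg; exact: cvg_cdfNy0.
have G_y : G @ +oo --> (1 : R).
  apply: (cvg_uniform_limit (l := fun=> 1) e0 F_G) => n.
    by rewrite subrr normr0.
  by rewrite idE; apply: fine_cvg; exact: cvg_cdfy1.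
have [phi phiG] := probability_of_cdf ndG rcG G_Ny G_y.
exists phi => n; apply: beta_dist_kolmogorov => x.
have E : fine (phi `]x, +oo[%classic) = 1 - G x.
  by rewrite -setCitvl probability_setC// phiG -EFinB.
have := F_G n x; rewrite FE E.
by rewrite !ler_norml => /andP[? ?]; apply/andP; split; lra.
Qed.

End completeness.

(** * Global stability of splitting increasing kernels *)

Section splitting.
Context (R : realType) (P : R.-pker R ~> R) (N : nat) (k c : R).
Hypotheses (N0 : (0 < N)%N) (c0 : 0 < c) (c1 : c < 1).
Hypothesis incP : increasing_kernel P.
Hypothesis splitP : splits (kernel_iter P N) k c.

(** The factor [2] bounds [beta]; each block of [N] steps contributes a factor
    [1 - c]. *)
Let rate t : R := 2 * (1 - c) ^+ (t %/ N).

Let rate_cvg0 : rate t @[t --> \oo] --> 0.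
Proof.
have divN : (t %/ N)%N @[t --> \oo] --> \oo.
  apply/cvgnyPge => A; near=> t.
  by rewrite leq_divRL//; near: t; exact: nbhs_infty_ge.
rewrite -(mulr0 2); apply: cvgMl_tmp; apply: (cvg_comp _ _ divN).
by apply: cvg_expr; rewrite ger0_norm ?subr_ge0 ?(ltW c1)// ltrBlDr ltrDl.
Unshelve. all: by end_near. Qed.

Let beta_dist_rate phi psi t :
  beta_dist (kernel_push phi (kernel_iter P t))
            (kernel_push psi (kernel_iter P t)) <= rate t.
Proof.
have := beta_dist_contract_iter phi psi (t %/ N) (t %% N) c1 incP splitP.
rewrite -divn_eq => /le_trans; apply.
by rewrite /rate mulrC ler_wpM2r ?beta_dist_le2// exprn_ge0// subr_ge0 ltW.
Qed.

Let le_rate0 (x C : R) : (forall t, x <= C * rate t) -> x <= 0.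
Proof.
move=> H; rewrite -(mulr0 C).
have cC : C * rate t @[t --> \oo] --> C * 0 by exact: cvgMl_tmp.
by apply: (cvgr_to_ge cC); exact: nearW.
Qed.

(** A fixed-point argument for contractions: the iterates from any law form a
    Cauchy sequence, since the iterate at time [n + m] is the iterate at time
    [n] from another law, and the limit attracts every law at the same rate. *)
Theorem splitting_globally_stable : globally_stable P.
Proof.
pose phi0 : probability R R := kernel_law P 0.
pose mu t : probability R R := kernel_push phi0 (kernel_iter P t).
have cauchy_mu n m : beta_dist (mu n) (mu (n + m)%N) <= rate n.
  pose nu : probability R R := kernel_push phi0 (kernel_iter P m).
  have E : same_law (mu (n + m)%N) (kernel_push nu (kernel_iter P n)).
    by move=> B mB; rewrite /mu addnC; exact: kernel_push_iterD.
  rewrite (@beta_dist_same_law _ (mu n) (mu n) _ _ _ E)//.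
  exact: beta_dist_rate.
have [phis mu_phis] := beta_dist_complete rate_cvg0 cauchy_mu.
have phisP (phi : probability R R) t :
    beta_dist (kernel_push phi (kernel_iter P t)) phis <= 3 * rate t.
  have -> : 3 * rate t = rate t + 2 * rate t by ring.
  rewrite (le_trans (beta_dist_triangle (mu t) _ _))// lerD//.
  exact: beta_dist_rate.
exists phis; split.
- (* [mu t P] is also an iterate, so it is close to the limit, and [P] does not
     increase its distance to the image of the limit. *)
  apply: beta_dist_eq0; apply/eqP; rewrite eq_le beta_dist_ge0 andbT.
  apply: (@le_rate0 _ 5) => t.
  pose phi1 : probability R R := kernel_push phi0 (kernel_iter P 1).
  have E : same_law (kernel_push (mu t) P) (kernel_push phi1 (kernel_iter P t)).
    move=> B mB; transitivity (kernel_push phi0 (kernel_iter P t.+1) B).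
      by apply/esym; exact: kernel_push_comp.
    by rewrite -[t.+1]add1n; exact: kernel_push_iterD.
  have -> : 5 * rate t = 2 * rate t + 3 * rate t by ring.
  rewrite (le_trans (beta_dist_triangle (kernel_push (mu t) P) _ _))// lerD//.
    by rewrite (le_trans (beta_dist_push_le _ _ incP))// beta_distC.
  by rewrite (@beta_dist_same_law _ _ _ phis phis E).
- move=> psi psiP; apply: beta_dist_eq0; apply/eqP.
  rewrite eq_le beta_dist_ge0 andbT.
  apply: (@le_rate0 _ 3) => t.
  have E : same_law psi (kernel_push psi (kernel_iter P t)).
    elim: t => [|t IH] B mB; apply/esym; first exact: kernel_push_iter0.
    apply: etrans (psiP B mB); apply: etrans (kernel_push_comp _ _ _ mB) _.
    by apply: kernel_push_eq => A mA; rewrite IH.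
  by rewrite (@beta_dist_same_law _ _ _ phis phis E).
- move=> phi; apply: (@squeeze_cvgr _ _ _ _ (cst 0) (fun t => 3 * rate t)).
  + by apply: nearW => t; rewrite beta_dist_ge0 phisP.
  + exact: cvg_cst.
  + by rewrite -(mulr0 3); apply: cvgMl_tmp.
Qed.

End splitting.

(** * The belief shock kernel *)

Section belief_shock.
Context (R : realType) (rho : R) (Q : R.-pker R ~> R) (nu : probability R R).
Hypothesis rho01 : 0 < rho < 1.

Let P : R.-pker R ~> R := belief_kernel rho Q nu.

Let rho_ge0 : 0 <= rho. Proof. by case/andP: rho01 => /ltW. Qed.
Let rhoC_ge0 : 0 <= 1 - rho.
Proof. by case/andP: rho01 => _ /ltW; rewrite subr_ge0. Qed.

Lemma measurable_translation (x : R) : measurable_fun setT (fun z : R => x + z).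
Proof. exact: measurable_funD. Qed.

Lemma measurable_translate_set (x : R) (A : set R) : measurable A ->
  measurable [set z | A (x + z)].
Proof.
by move=> mA; rewrite -[X in measurable X]setTI; exact: measurable_translation.
Qed.

Lemma ge0_integral_belief_kernel (f : R -> \bar R) x :
  measurable_fun setT f -> (forall y, (0 <= f y)%E) ->
  (\int[P x]_y f y =
   rho%:E * \int[Q x]_y f y + (1 - rho)%:E * \int[nu]_z f (x + z)%R)%E.
Proof.
move=> mf f0.
pose shift : {RV nu >-> R} := mfun_Sub (mem_set (measurable_translation x)).
pose m1 := mscale (NngNum rho_ge0) (Q x).
pose m2 := mscale (NngNum rhoC_ge0) (distribution nu shift).
rewrite (eq_measure_integral (measure_add m1 m2)); last first.
  move=> A mA _; rewrite [LHS]belief_kernelE//; last first.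
    by rewrite rho_ge0 -subr_ge0.
  exact/esym/measure_addE.
rewrite ge0_integral_measure_add// !ge0_integral_mscale//=.
by rewrite ge0_integral_distribution.
Qed.

Lemma belief_kernel_fun (h : R -> R) (M x : R) : measurable_fun setT h ->
  (forall x, `|h x| <= M) ->
  kernel_fun P h x =
    rho * kernel_fun Q h x + (1 - rho) * \int[nu]_z h (x + z).
Proof.
move=> mh hM.
have M0 y := bounded_shift_ge0 y hM.
have mhM : measurable_fun setT (fun x => h x + M) by exact: measurable_funD.
have bM y := bounded_shift_le y hM.
have mhx : measurable_fun setT (fun z => h (x + z)).
  by apply: measurableT_comp => //; exact: measurable_translation.
have mhxM : measurable_fun setT (fun z => h (x + z) + M).
  exact: measurable_funD.
have mE : measurable_fun setT (fun y => (h y + M)%:E) by exact/measurable_EFinP.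
have H := ge0_integral_belief_kernel x mE
  (fun y => M0 y : (0 <= (h y + M)%:E)%E).
have E1 := EFin_Rintegral_prob (kernel_law P x) mhM bM.
have E2 := EFin_Rintegral_prob (kernel_law Q x) mhM bM.
have E3 := EFin_Rintegral_prob nu mhxM (fun z => bM (x + z)).
move: H; rewrite [LHS](esym E1) [X in _ = (_ * X + _)%E](esym E2) -E3.
rewrite -!EFinM -EFinD !(RintegralD_cst _ _ mh hM).
rewrite (RintegralD_cst _ _ mhx (fun z => hM (x + z))) => -[].
rewrite /kernel_fun /kernel_law => H; apply: (addIr M); rewrite H; ring.
Qed.

Lemma increasing_belief_kernel : increasing_kernel Q -> increasing_kernel P.
Proof.
move=> iQ h ih x y xy; have [mono mh [M hM]] := ih.
have E z := belief_kernel_fun z mh hM.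
rewrite /kernel_fun in E.
rewrite !E lerD ?ler_wpM2l//; first exact: iQ.
have i z : nu.-integrable setT (EFin \o (fun t => h (z + t))).
  apply: (@prob_bounded_integrable _ _ _ nu _ M) => //.
  by apply: measurableT_comp => //; exact: measurable_translation.
apply: le_Rintegral; [by []|exact: i|exact: i|].
by move=> z _; apply: mono; rewrite lerD2r.
Qed.

Lemma belief_kernel_fine x (A : set R) : measurable A ->
  fine (P x A) = rho * fine (Q x A) + (1 - rho) * fine (nu [set z | A (x + z)]).
Proof.
move=> mA; rewrite belief_kernelE//; last by rewrite rho_ge0 -subr_ge0.
have mxA := measurable_translate_set x mA.
have Qf : Q x A \is a fin_num by exact: (fin_num_measure (kernel_law Q x)).
have nuf : nu [set z | A (x + z)] \is a fin_num by exact: fin_num_measure.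
by rewrite fineD ?fin_numM// !fineM.
Qed.

(** The chain ends above [k] if it is first reset into [[-k, k]] and then moves
    by a signal above [2 k]; it ends below [k] if it is reset into [[-k, k]] at
    the second step. A single step would not do, because the jump needed to pass
    [k] is unbounded as the starting point decreases. *)
Lemma splits_belief_kernel (k : R) : 0 <= k ->
  (forall x, 1 / 2 <= fine (Q x `[- k, k]%classic)) ->
  splits (kernel_iter P 2) k
    (rho / 2 * ((1 - rho) * fine (nu `]2 * k, +oo[%classic))).
Proof.
move=> k0 Qk x.
set p := fine (nu _).
have p01 : 0 <= p <= 1.
  by rewrite fine_ge0//= -lee_fin fineK ?fin_num_measure// probability_le1.
have i1 := @normr_indic_le1 _ R R.
have E A : measurable A ->
    fine (kernel_iter P 2 x A) = kernel_fun P (fun y => fine (P y A)) x.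
  move=> mA.
  have mi : measurable_fun setT (\1_A : R -> R) by exact: measurable_indic.
  have bP y := kernel_fun_le P y mi (i1 A).
  have mP := measurable_kernel_fun P mi (i1 A).
  rewrite -kernel_fun_indic// (kernel_fun_comp _ _ _ mi (i1 A)).
  rewrite (kernel_fun_comp _ _ _ mP bP) (kernel_fun_iter0 P).
    by apply: eq_Rintegral => y _; rewrite kernel_fun_indic.
  exact: (measurable_kernel_fun P mP bP).
have mfP (A : set R) : measurable A -> (kernel_law P x).-integrable setT
    (EFin \o (fun y => fine (P y A))).
  move=> mA; have mi : measurable_fun setT (\1_A : R -> R).
    exact: measurable_indic.
  rewrite (_ : (fun _ => _) = kernel_fun P \1_A); last first.
    by apply/funext => y; rewrite kernel_fun_indic.
  apply: prob_bounded_integrable (measurable_kernel_fun P mi (i1 A)) _ => y.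
  exact: kernel_fun_le mi (i1 A).
have leP (m : probability R R) (A B : set R) : measurable A -> measurable B ->
    A `<=` B -> fine (m A) <= fine (m B).
  by move=> mA mB AB; rewrite fine_le ?fin_num_measure// le_measure ?inE.
have nonneg (m : probability R R) A : 0 <= fine (m A) by rewrite fine_ge0.
(* A reset into the interval has probability at least [rho / 2]. *)
have PK y (B : set R) : measurable B -> `[- k, k]%classic `<=` B ->
    rho / 2 <= fine (P y B).
  move=> mB KB; rewrite belief_kernel_fine// -[leLHS]addr0 lerD ?mulr_ge0//.
  rewrite ler_wpM2l// -[leLHS]mul1r (le_trans (Qk y))//.
  exact: (leP (kernel_law Q y)).
have [p0 p1] := andP p01; have [r0 r1] := andP rho01.
split; rewrite E//.
- rewrite mulrC.
  apply: (@le_trans _ _ (\int[kernel_law P x]_y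
     ((1 - rho) * p * \1_(`[- k, k]%classic) y + 0))).
    rewrite (@Rintegral_affine _ _ _ _ _ 1)// Rintegral_indic_prob// addr0.
    by rewrite ler_wpM2l ?mulr_ge0//; exact: PK.
  apply: le_Rintegral => //; [|exact: mfP|].
    apply: (@prob_bounded_integrable _ _ _ _ _ ((1 - rho) * p)).
      by apply: measurable_funD => //; apply: measurable_funM.
    by move=> y; rewrite addr0 normrM ger0_norm ?mulr_ge0// ler_piMr ?mulr_ge0.
  move=> y _; rewrite addr0 belief_kernel_fine//.
  rewrite indicE; case: (boolP (y \in _)); last first.
    by rewrite mulr0 addr_ge0// mulr_ge0// (nonneg (kernel_law Q y)).
  rewrite inE/= in_itv/= mulr1 => /andP[ky _].
  rewrite -[leLHS]add0r lerD ?mulr_ge0 ?(nonneg (kernel_law Q y))//.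
  rewrite ler_wpM2l//; apply: leP => //.
    exact: (measurable_translate_set y (measurable_itv `]k, +oo[)).
  by move=> z; rewrite /= !in_itv/= !andbT; lra.
- rewrite -(Rintegral_prob_cst (kernel_law P x) (_ * _)).
  apply: le_Rintegral => //; [exact: finite_measure_integrable_cst|exact: mfP|].
  move=> y _; apply: (@le_trans _ _ (rho / 2)); first by nra.
  by apply: PK => // z /=; rewrite !in_itv/= => /andP[].
Qed.

Theorem belief_kernel_globally_stable (k : R) : increasing_kernel Q -> 0 <= k ->
  (forall x, 1 / 2 <= fine (Q x `[- k, k]%classic)) ->
  0 < fine (nu `]2 * k, +oo[%classic) -> globally_stable P.
Proof.
move=> iQ k0 Qk nuk; have splitP := splits_belief_kernel k0 Qk.
have nu1 : fine (nu `]2 * k, +oo[%classic) <= 1.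
  by rewrite -lee_fin fineK ?fin_num_measure// probability_le1.
have [r0 r1] := andP rho01.
apply: (splitting_globally_stable _ _ _ _ splitP); first by [].
- by rewrite !mulr_gt0// subr_gt0.
- by nra.
- exact: increasing_belief_kernel.
Qed.

End belief_shock.

Lemma lt_expR_lne (R : realType) (m : R) (x : \bar R) :
  ((expR m)%:E < x)%E = (m%:E < lne x)%E.
Proof.
case: x => [r| |]/=; last 2 first.
- by rewrite !ltry.
- by rewrite !ltNge !leNye.
rewrite lte_fin; case: ifPn => [r0|].
  by rewrite !ltNge leNye/= (le_trans r0)// expR_ge0.
by rewrite -ltNge lte_fin => r0; rewrite -[RHS]ltr_expR lnK.
Qed.

Theorem proposition6p1 (R : realType)
    (d : measure_display) (T : measurableType d)
    (mu : {measure set T -> \bar R}) (fh fl : {mfun T >-> R})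
    (hfh : is_density mu fh) (hfl : is_density mu fl)
    (d' : measure_display) (Omega : measurableType d')
    (Pr : probability Omega R) (Z : {RV Pr >-> T})
    (hZ : forall A, measurable A ->
      distribution Pr Z A = (\int[mu]_(z in A) (fh z)%:E)%E)
    (rho : R) (hrho : 0 < rho < 1)
    (Q : R.-pker R ~> R) (hQ : increasing_kernel Q)
    (A1 : finite_variance Pr (log_likelihood fh fl Z))
    (A2 : forall eps : R, 0 < eps -> exists2 K : set R, compact K &
      ((1 - eps)%:E <= ereal_inf [set Q x K | x in [set: R]])%E)
    (A3 : forall M : R, 0 < M ->
      (0 < Pr [set w | M%:E < likelihood_ratio fh fl (Z w)])%E) :
  globally_stable
    (belief_kernel rho Q (distribution Pr (log_likelihood_shock fh fl Z))).
Proof.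
set nu : probability R R := distribution Pr (log_likelihood_shock fh fl Z).
(* The log-likelihood is almost surely finite, so replacing its infinite values
   by 0 does not affect the probability, positive by [A3], that it exceeds
   [m]. *)
have nu_gt0 m : 0 < fine (nu `]m, +oo[%classic).
  have [[N [mN N0 fN]] _] := A1.
  have mray : measurable (log_likelihood_shock fh fl Z @^-1` `]m, +oo[%classic).
    exact: measurable_funPTI.
  rewrite fine_gt0// -ge0_fin_numE// fin_num_measure// andbT.
  rewrite lt0e measure_ge0 andbT; apply/eqP => nu0.
  have := A3 _ (expR_gt0 m); rewrite ltNge => /negP; apply.
  apply: (@le_trans _ _
    (Pr (N `|` log_likelihood_shock fh fl Z @^-1` `]m, +oo[%classic))).
    apply: le_measure; rewrite ?inE.
    - under eq_set do rewrite lt_expR_lne.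
      rewrite -[X in measurable X]setTI.
      apply: emeasurable_fun_o_infty => //.
      exact: measurable_log_likelihood.
    - exact: measurableU.
    - move=> w /=; rewrite lt_expR_lne => mw.
      have [wfin|/fN] := pselect (log_likelihood fh fl Z w \is a fin_num);
        last by left.
      by right; rewrite in_itv/= andbT -lte_fin /log_likelihood_shock /= fineK.
  apply: le_trans (measureU2 Pr mN mray) _.
  by rewrite [X in (X + _)%E]N0 [X in (_ + X)%E]nu0 adde0.
(* [A2] puts half of the mass of every [Q x] in one symmetric interval. *)
have [K cK infK] := A2 (1 / 2) ltac:(lra).
have [k [_ Kk]] := compact_bounded cK.
pose k' := `|k| + 1.
have k'0 : 0 <= k' by rewrite addr_ge0.
have mK : measurable K by apply: closed_measurable; exact: compact_closed.
have Qk x : 1 / 2 <= fine (Q x `[- k', k']%classic).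
  rewrite -lee_fin fineK; last exact: (fin_num_measure (kernel_law Q x)).
  apply: (@le_trans _ _ (Q x K)).
    have -> : 1 / 2 = 1 - 1 / 2 :> R by lra.
    apply: le_trans infK _; apply: ereal_inf_lbound.
    by exists x.
  apply: le_measure; rewrite ?inE// => y Ky /=.
  rewrite in_itv/= -ler_norml; apply: Kk => //.
  by rewrite /k' ltr_pwDr// ler_norm.
exact: (belief_kernel_globally_stable hrho hQ k'0 Qk (nu_gt0 _)).
Qed.
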